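(* Let $\mathcal{X}$ be an infinite-dimensional Hilbert space and let $T\in\mathcal{B}[\mathcal{X}]$ be a power bounded operator. If $T$ is hyponormal, then $T$ is a contraction and either (i) $T$ is not weakly l-sequentially supercyclic, or (ii) if $y\in\mathcal{X}$ is a weakly l-sequentially supercyclic vector for $T$, then $T$ is unitary and every nonzero $z\in\mathcal{X}$ is such that either $$\liminf_n|\langle T^ny\,;z\rangle|=0,$$ or $$\limsup_k|\langle T^{n_k}y\,;z\rangle|<\|z\|\,\|y\|$$ for some subsequence $\{T^{n_k}\}_{k\ge0}$ of $\{T^n\}_{n\ge0}$.
   Context: The scalar field is $\mathbb{F}$, either $\mathbb{R}$ or $\mathbb{C}$. $\langle\,\cdot\,;\cdot\,\rangle$ denotes the inner product. $\mathcal{B}[\mathcal{X}]$ is the algebra of all operators (bounded linear maps) of $\mathcal{X}$ into itself. $T$ is power bounded if $\sup_{n\ge0}\|T^n\|<\infty$, a contraction if $\|T\|\le1$, unitary if it is an invertible isometry, and hyponormal if $\|T^*x\|\le\|Tx\|$ for every $x\in\mathcal{X}$, where $T^*$ is the adjoint of $T$. A nonzero vector $y\in\mathcal{X}$ is a weakly l-sequentially supercyclic vector for $T$ if for every $x\in\mathcal{X}$ there exist a sequence $\{\alpha_k\}_{k\ge0}$ of nonzero numbers in $\mathbb{F}$ and a subsequence $\{T^{n_k}\}_{k\ge0}$ of $\{T^n\}_{n\ge0}$ (both depending on $x$ and $y$) such that $\alpha_kT^{n_k}y$ converges weakly to $x$. $T$ is weakly l-sequentially supercyclic if it has a weakly l-sequentially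 supercyclic vector. *)

(* Defs.v *)
From HB Require Import structures.
From mathcomp Require Import all_boot all_order all_algebra.
From mathcomp Require Import complex.
From mathcomp Require Import all_classical all_reals all_analysis.

Set Implicit Arguments.
Unset Strict Implicit.
Unset Printing Implicit Defensive.

Import Order.TTheory GRing.Theory Num.Theory.
Import numFieldNormedType.Exports.

Local Open Scope classical_set_scope.
Local Open Scope ring_scope.

Variant scalar_kind := RealScalars | ComplexScalars.

Definition scalar_field (R : realType) (k : scalar_kind) : numFieldType :=
  match k with RealScalars => R | ComplexScalars => R[i] end.

Definition sconj (R : realType) (k : scalar_kind) :
    scalar_field R k -> scalar_field R k :=
  match k with RealScalars => idfun | ComplexScalars => @conjc R end.

(* The library norms take their values in the scalar field itself; suprema,
   liminf and limsup need the value in R. *)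
Definition modulus (R : realType) (k : scalar_kind) : scalar_field R k -> R :=
  match k with
  | RealScalars => fun a => `|a|
  | ComplexScalars => fun a : R[i] => complex.Re `|a|
  end.

Arguments sconj {R k}.
Arguments modulus {R k}.

Section Operators.
Context {R : realType} {k : scalar_kind}.
Context {X : completeNormedModType (scalar_field R k)}.
Implicit Types (T : X -> X) (dot : {dot X for sconj}) (x y z : X).

Definition rnorm x : R := modulus `|x|.

Definition inner_product_norm dot : Prop := forall x, `|x| ^+ 2 = dot x x.

Definition opnorm T : \bar R :=
  ereal_sup [set (rnorm (T x))%:E | x in [set x | rnorm x <= 1]].

Definition bounded_operator T : Prop := (opnorm T < +oo)%E.

Definition power_bounded T : Prop :=
  (ereal_sup (range (fun n => opnorm (iter n T))) < +oo)%E.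

Definition contraction_operator T : Prop := (opnorm T <= 1)%E.

Definition unitary_operator T : Prop := bijective T /\ forall x, `|T x| = `|x|.

(* The default value 0 of xget is never used for bounded linear T: the
   defining vector exists by the Riesz representation theorem. *)
Definition adjoint dot T y : X :=
  xget 0 [set w | forall x, dot (T x) y = dot x w].

Definition hyponormal dot T : Prop :=
  forall x, `|adjoint dot T x| <= `|T x|.

Definition weakly_cvg (u : nat -> X) x : Prop :=
  forall f : {scalar X}, continuous f -> f (u j) @[j --> \oo] --> f x.

Definition weakly_l_sequentially_supercyclic_vector T y : Prop :=
  y != 0 /\
  forall x, exists (a : nat -> scalar_field R k) (n : nat -> nat),
    [/\ forall j, a j != 0, increasing_seq n &
        weakly_cvg (fun j => a j *: iter (n j) T y) x].

Definition weakly_l_sequentially_supercyclic T : Prop :=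
  exists y, weakly_l_sequentially_supercyclic_vector T y.

End Operators.

Definition infinite_dimensional (K : numFieldType) (X : lmodType K) : Prop :=
  ~ exists (m : nat) (e : 'I_m -> X),
      forall x, exists c : 'I_m -> K, x = \sum_(i < m) c i *: e i.

(* Main.v *)
Require Import Defs.
From HB Require Import structures.
From mathcomp Require Import all_boot all_order all_algebra.
From mathcomp Require Import complex.
From mathcomp Require Import all_classical all_reals all_analysis.
From mathcomp Require Import zify ring lra.

(** In an infinite-dimensional Hilbert space a power bounded hyponormal
    operator T is a contraction and has no weakly l-sequentially supercyclic
    vector at all, so the first alternative always holds.

    Hyponormality gives |Tx|^2 <= |T*Tx| |x| <= |T^2 x| |x|: the norms along any
    orbit form a log-convex sequence.  If |Tx| > |x| they grow at least
    geometrically, which power boundedness forbids; hence T is a contraction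
    ([hyponormal_contraction]).

    Suppose that y is supercyclic.  Every x is a weak limit of vectors
    u_j = a_j T^(n_j) y, which are norm bounded by uniform boundedness.  The
    ratios |T^(n+1) y| / |T^n y| increase to a limit r > 0, and hyponormality
    turns this into T*T u_j - r^2 u_j --> 0 in norm; in the weak limit
    T*T x = r^2 x ([supercyclic_hyponormal_isometry]).  The multiples of the
    orbit being weakly dense, T has dense range; hence also TT* = r^2, and
    U = T / r is unitary.

    In infinite dimension a unitary U has no such vector.  All U^n y have norm
    |y|, so the
    coefficients of U^(n_j) y stay bounded, and uniform boundedness applied to
    the z with sup_n |<U^n y; z>| <= 1 yields d > 0 with
    d |z| <= sup_n |<U^n y; z>| for all z ([norming_orbit]).  Apply this to
    z = B^2 y where B = p(A) is a real polynomial in A = U + U*: as B is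
    self-adjoint and commutes with U,
    |<U^n y; B^2 y>| = |<U^n B y; B y>| <= |By|^2, whence d |B^2 y| <= |By|^2.
    In terms of the spectral measure mu of A at y, this says that
    d ||f||_2 <= ||f||_1 for f = p^2, which forces mu to be a finite sum of
    atoms.  The proof finds the atoms without a spectral theorem: the
    inequality makes the normalised even powers of B applied to y converge to
    a vector w with B^2 w = r^2 w and |w| >= d ([stationary_vector]);
    replacing p by p (p^2 - r^2) and iterating gives mutually orthogonal
    vectors w, each the projection of y on its own line, whose number is at
    most |y|^2 / d^2 by Bessel's inequality.  So the iteration stops, that is
    p(A) y = 0 for some p != 0 ([algebraic_vector]).  Then the orbit of y lies
    in a finite-dimensional subspace; such a subspace is weakly closed and must
    be the whole space ([supercyclic_finite_dimensional]).

    All estimates take place in the real Hilbert space underlying X, with inner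
    product Re <.;.>, so that real and complex scalars are treated at once. *)

Set Implicit Arguments.
Unset Strict Implicit.
Unset Printing Implicit Defensive.

Import Order.TTheory GRing.Theory Num.Theory.
Import numFieldNormedType.Exports.

Local Open Scope classical_set_scope.
Local Open Scope ring_scope.

(** * Real inner product spaces *)

Lemma cvg_dist_le (R : realType) (u : nat -> R) l (v : nat -> R) :
  (forall n, `|u n - l| <= v n) -> v n @[n --> \oo] --> (0 : R) ->
  u n @[n --> \oo] --> l.
Proof.
move=> uv v0; apply/subr_cvg0; apply: norm_cvg0.
by apply: squeeze_cvgr (cvg_cst 0) v0; apply: nearW => n; rewrite normr_ge0 uv.
Qed.

Section RealInnerProduct.
Context {R : realType} {V : lmodType R} (g : {dot V for @idfun R}).
Implicit Types x y z : V.

Definition enorm x : R := Num.sqrt (g x x).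

Lemma ipC x y : g x y = g y x.
Proof. by rewrite (@hermitian_subproof _ _ false idfun g) expr0 mul1r. Qed.

Lemma ipDl x y z : g (x + y) z = g x z + g y z.
Proof. exact: linearDl. Qed.
Lemma ipBl x y z : g (x - y) z = g x z - g y z.
Proof. exact: linearBl. Qed.
Lemma ipZl a x z : g (a *: x) z = a * g x z.
Proof. exact: linearZl_LR. Qed.
Lemma ipNl x z : g (- x) z = - g x z.
Proof. exact: linearNl. Qed.
Lemma ip0l z : g 0 z = 0.
Proof. exact: linear0l. Qed.
Lemma ipDr x y z : g z (x + y) = g z x + g z y.
Proof. by rewrite ipC ipDl !(ipC z). Qed.
Lemma ipBr x y z : g z (x - y) = g z x - g z y.
Proof. by rewrite ipC ipBl !(ipC z). Qed.
Lemma ipZr a x z : g z (a *: x) = a * g z x.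
Proof. by rewrite ipC ipZl !(ipC z). Qed.
Lemma ip0r z : g z 0 = 0.
Proof. by rewrite ipC ip0l. Qed.
Lemma ipNr x z : g z (- x) = - g z x.
Proof. by rewrite ipC ipNl !(ipC z). Qed.

Definition ipE := (ipDl, ipDr, ipNl, ipNr, ipZl, ipZr).

Lemma ip_ge0 x : 0 <= g x x.
Proof.
have [->|x0] := eqVneq x 0; first by rewrite ip0l.
exact/ltW/neq0_dnorm_gt0.
Qed.

Lemma ip_eq0 x : g x x = 0 -> x = 0.
Proof.
move=> gx; apply/eqP/negPn/negP => /neq0_dnorm_gt0-/(_ _ g).
by rewrite gx ltxx.
Qed.

Lemma eq_ip x y : (forall z, g x z = g y z) -> x = y.
Proof.
by move=> xy; apply/subr0_eq/ip_eq0; rewrite ipBl xy subrr.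
Qed.

Lemma enorm_ge0 x : 0 <= enorm x. Proof. exact: sqrtr_ge0. Qed.
Hint Resolve enorm_ge0 : core.

Lemma sqr_enorm x : enorm x ^+ 2 = g x x.
Proof. by rewrite sqr_sqrtr ?ip_ge0. Qed.

Lemma enorm_eq0 x : enorm x = 0 -> x = 0.
Proof. by move=> x0; apply: ip_eq0; rewrite -sqr_enorm x0 expr0n. Qed.

Lemma enorm_gt0 x : x != 0 -> 0 < enorm x.
Proof.
by move=> x0; rewrite lt_def enorm_ge0 andbT; apply: contra_neq x0 => /enorm_eq0.
Qed.

Lemma enorm0 : enorm 0 = 0.
Proof. by rewrite /enorm ip0l sqrtr0. Qed.

Lemma enormN x : enorm (- x) = enorm x.
Proof. by rewrite /enorm ipNl ipNr opprK. Qed.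

Lemma enormZ a x : enorm (a *: x) = `|a| * enorm x.
Proof.
by rewrite /enorm ipZl ipZr mulrA -expr2 sqrtrM ?sqr_ge0// sqrtr_sqr.
Qed.

Lemma enormBC x y : enorm (x - y) = enorm (y - x).
Proof. by rewrite -enormN opprB. Qed.

Lemma cauchy_schwarz x y : `|g x y| <= enorm x * enorm y.
Proof.
have [->|y0] := eqVneq y 0; first by rewrite ip0r normr0 enorm0 mulr0.
have y_gt0 : 0 < g y y by exact: neq0_dnorm_gt0.
rewrite -(@ler_pXn2r _ 2)// ?nnegrE ?mulr_ge0// exprMn !sqr_enorm.
rewrite real_normK ?num_real//.
have := ip_ge0 (x - (g x y / g y y) *: y).
rewrite !ipE (ipC y x) => h.
have {h} : 0 <= g x x - g x y ^+ 2 / g y y.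
  apply: le_trans h _; rewrite le_eqVlt; apply/orP; left; apply/eqP.
  by field; rewrite gt_eqF.
by rewrite subr_ge0 ler_pdivrMr.
Qed.

Lemma ip_le x y : g x y <= enorm x * enorm y.
Proof. exact: le_trans (ler_norm _) (cauchy_schwarz _ _). Qed.

Lemma enormD x y : enorm (x + y) <= enorm x + enorm y.
Proof.
rewrite -(@ler_pXn2r _ 2)// ?nnegrE ?addr_ge0// sqrrD !sqr_enorm !ipE.
by have := ip_le x y; rewrite (ipC y x); lra.
Qed.

(** [V] carries no topology of its own, hence norm limits, Cauchy sequences and
    weak limits are expressed through the form [g]. *)
Definition ecvg (u : nat -> V) l := enorm (u n - l) @[n --> \oo] --> (0 : R).

Definition ecauchy (u : nat -> V) := forall e : R, 0 < e ->
  exists N, forall m n, (N <= m)%N -> (N <= n)%N -> enorm (u m - u n) < e.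

Definition ecomplete := forall u, ecauchy u -> exists l, ecvg u l.

Definition wcvg (u : nat -> V) x := forall z, g (u n) z @[n --> \oo] --> g x z.

Lemma ecvg_wcvg u l : ecvg u l -> wcvg u l.
Proof.
move=> ul z; apply: (@cvg_dist_le _ _ _ (fun n => enorm (u n - l) * enorm z)).
  by move=> n; rewrite -ipBl cauchy_schwarz.
rewrite -(mul0r (enorm z)); apply: cvgM; [exact: ul|exact: cvg_cst].
Qed.

Lemma ecvg_dist_le u l a c N : ecvg u l ->
  (forall m, (N <= m)%N -> enorm (u m - a) <= c) -> enorm (l - a) <= c.
Proof.
move=> ul uc.
have h : enorm (u n - l) + c @[n --> \oo] --> 0 + c by apply: cvgD => //; exact: cvg_cst.
rewrite -[leRHS]add0r; apply: (cvgr_to_ge h).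
exists N => // n /= Nn.
rewrite (_ : l - a = - (u n - l) + (u n - a)); last by rewrite opprB addrA subrK.
by apply: le_trans (enormD _ _) _; rewrite enormN lerD2l uc.
Qed.

(** Gliding hump: if [Z] contained z_n with |z_n| > 6^n, then adding steps of
    length 3^-n along +z_n or -z_n, the sign being chosen so that |<z_n; x>|
    increases, would produce a limit [l] with |<z_n; l>| >= 2^n / 2, because the
    steps after the n-th have total length only 3^-n / 2. *)
Theorem uniform_boundedness (Z : set V) : ecomplete ->
  (forall x, exists M, forall z, Z z -> `|g z x| <= M) ->
  exists M, forall z, Z z -> enorm z <= M.
Proof.
move=> gcomp Zpt; apply: contrapT => /forallNP Zunb.
have /choice[z zP] n : exists z, Z z /\ 6 ^+ n < enorm z.
  apply: contrapT => zN; apply: (Zunb (6 ^+ n)) => z Zz.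
  by rewrite leNgt; apply/negP => zn; apply: zN; exists z.
have z_gt0 n : 0 < enorm (z n) by apply: le_lt_trans (zP n).2; rewrite exprn_ge0.
pose q : R := 3^-1.
have q_gt0 n : 0 < q ^+ n by rewrite exprn_gt0// invr_gt0.
pose sgn (b : bool) : R := (-1) ^+ b.
pose step n x := (sgn (g (z n) x < 0) * (q ^+ n / enorm (z n))) *: z n.
pose x := fix x n := if n is m.+1 then x m + step m (x m) else 0.
have xS n : x n.+1 = x n + step n (x n) by [].
have x_step n : enorm (x n.+1 - x n) = q ^+ n.
  rewrite xS addrC addKr enormZ normrM normrX normrN1 expr1n mul1r.
  rewrite ger0_norm ?divr_ge0// ?(ltW (q_gt0 n))//.
  by rewrite divfK// gt_eqF.
have x_tail n j : enorm (x (j + n)%N - x n) <= 3 / 2 * (q ^+ n - q ^+ (j + n)).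
  elim: j => [|j IH]; first by rewrite !subrr enorm0 mulr0.
  rewrite addSn -(subrK (x (j + n)%N) (x (j + n).+1)) -addrA.
  apply: le_trans (enormD _ _) _; rewrite x_step.
  apply: le_trans (lerD (lexx _) IH) _.
  by rewrite [in leRHS]exprS /q; lra.
have x_big n : q ^+ n * enorm (z n) <= `|g (z n) (x n.+1)|.
  rewrite xS ipDr ipZr -sqr_enorm -mulrA.
  rewrite (_ : q ^+ n / enorm (z n) * enorm (z n) ^+ 2 = q ^+ n * enorm (z n)); last first.
    by field; rewrite gt_eqF.
  have := mulr_gt0 (q_gt0 n) (z_gt0 n); set c := _ * _ => c_gt0.
  case: ltP => h; rewrite /sgn ?expr1 ?expr0.
    by rewrite ltr0_norm; lra.
  by rewrite ger0_norm; lra.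
have [l xl] : exists l, ecvg x l.
  apply: gcomp => e e0.
  have [N Ne] : exists N, 3 * q ^+ N < e.
    have h : 3 * q ^+ n @[n --> \oo] --> 3 * (0 : R).
      by apply: cvgMl_tmp; apply: cvg_expr; rewrite ger0_norm /q; lra.
    rewrite mulr0 in h.
    have [N _ /(_ N (leqnn _))/=] := cvgr_lt _ h _ e0.
    by exists N.
  exists N => m n Nm Nn; apply: le_lt_trans Ne.
  rewrite (_ : x m - x n = (x m - x N) + - (x n - x N)); last first.
    by rewrite opprB addrA subrK.
  apply: le_trans (enormD _ _) _; rewrite enormN.
  have := x_tail N (m - N)%N; have := x_tail N (n - N)%N; rewrite !subnK//.
  by have := q_gt0 m; have := q_gt0 n; lra.
have [M ZM] := Zpt l.
have bound n : 2 ^+ n <= 2 * M.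
  have h1 : enorm (l - x n.+1) <= q ^+ n / 2.
    apply: (ecvg_dist_le (N := n.+1)) xl _ => m nm.
    have := x_tail n.+1 (m - n.+1)%N; rewrite subnK// => /le_trans; apply.
    by have := q_gt0 m; rewrite exprS /q; lra.
  have h2 : `|g (z n) (x n.+1)| <= M + enorm (z n) * (q ^+ n / 2).
    rewrite -(subrK l (x n.+1)) ipDr; apply: le_trans (ler_normD _ _) _.
    rewrite addrC lerD ?ZM//; first exact: (zP n).1.
    apply: le_trans (cauchy_schwarz _ _) _.
    by rewrite ler_wpM2l// enormBC.
  have h3 := x_big n.
  have h4 : 2 ^+ n <= q ^+ n * enorm (z n).
    rewrite (_ : 2 ^+ n = q ^+ n * 6 ^+ n).
      by rewrite ler_pM2l// ltW// (zP n).2.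
    by rewrite -exprMn; congr (_ ^+ _); rewrite /q; lra.
  by lra.
have M_ge0 : 0 <= 2 * M by apply: le_trans (bound 0%N).
have := archi_boundP M_ge0; apply/negP; rewrite -leNgt.
apply: le_trans (bound (Num.bound (2 * M))).
by rewrite -natrX ler_nat ltnW// ltn_expl.
Qed.

(** The representing vector minimises |x|^2 - 2 f(x).  A minimising sequence is
    Cauchy by the parallelogram identity, and the first variation of the
    functional at its limit [w] is 2 (<w; v> - f v). *)
Theorem riesz_representation (f : {scalar V}) C : ecomplete ->
  (forall x, `|f x| <= C * enorm x) -> exists w, forall x, f x = g x w.
Proof.
move=> gcomp fC; pose phi x := g x x - 2 * f x.
have fD x y : f (x + y) = f x + f y by exact: raddfD.
have fZ t x : f (t *: x) = t * f x by exact: linearZ.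
have phi_ge x : - C ^+ 2 <= phi x.
  rewrite /phi -sqr_enorm.
  have := fC x; have := ler_norm (f x); have := sqr_ge0 (enorm x - C).
  by rewrite sqrrB; lra.
have phi_inf : has_inf (range phi).
  by split; [exists (phi 0), 0|exists (- C ^+ 2) => _ [x _ <-]].
set m := inf (range phi).
have phi_m x : m <= phi x by apply: inf_lbound; [case: phi_inf|exists x].
have /choice[x xP] (n : nat) : exists x, phi x < m + n.+1%:R^-1.
  have n0 : (0 : R) < n.+1%:R^-1 by rewrite invr_gt0.
  by have [_ [x _ <-]] := inf_adherent n0 phi_inf; exists x.
(* The parallelogram identity, rewritten for [phi]: the linear terms cancel. *)
have par a b : g (a - b) (a - b) = 2 * phi a + 2 * phi b - 4 * phi (2^-1 *: (a + b)).
  by rewrite /phi fZ fD !ipE (ipC b a); field.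
have [w xw] : exists w, ecvg x w.
  apply: gcomp => e e0.
  have e2 : 0 < e ^+ 2 / 4 by rewrite divr_gt0// exprn_gt0.
  have [N _ HN0] := near_infty_natSinv_lt (PosNum e2); have /= HN := HN0 N (leqnn _).
  exists N => i j Ni Nj.
  rewrite -(@ltr_pXn2r _ 2)// ?nnegrE ?(ltW e0)//. rewrite sqr_enorm par.
  have hi : i.+1%:R^-1 <= N.+1%:R^-1 :> R by rewrite lef_pV2 ?posrE// ler_nat.
  have hj : j.+1%:R^-1 <= N.+1%:R^-1 :> R by rewrite lef_pV2 ?posrE// ler_nat.
  move: (phi_m (2^-1 *: (x i + x j))) (xP i) (xP j) hi hj HN.
  move: (phi (x i)) (phi (x j)) (phi (2^-1 *: _)) => a b c.
  move: (i.+1%:R^-1) (j.+1%:R^-1) (N.+1%:R^-1) (e ^+ 2) => a' b' c' d; lra.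
exists w => v.
have key t : 0 <= t ^+ 2 * g v v + 2 * t * (g w v - f v).
  have hc : t ^+ 2 * g v v + 2 * t * (g (x n) v - f v) + n.+1%:R^-1
      @[n --> \oo] --> t ^+ 2 * g v v + 2 * t * (g w v - f v) + 0.
    apply: cvgD; last exact: cvg_harmonic.
    apply: cvgD; first exact: cvg_cst.
    apply: cvgMl_tmp; apply: cvgB; last exact: cvg_cst.
    exact: ecvg_wcvg xw v.
  rewrite -[leRHS]addr0; apply: (cvgr_to_ge hc); apply: nearW => n.
  have := phi_m (x n + t *: v); have := xP n.
  rewrite /phi fD fZ !ipE (ipC v).
  rewrite -/m; move: (n.+1%:R^-1) (f v) => a b; lra.
(* [key] at t = - d / (|v|^2 + 1), nearly the minimiser but with a denominator
   that cannot vanish. *)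
rewrite ipC; apply/esym/subr0_eq; move: key; set d := g w v - f v.
have := ip_ge0 v; set a := g v v => a_ge0 /(_ (- d / (a + 1))).
have a1 : 0 < a + 1 by lra.
rewrite (_ : _ + _ = - (d ^+ 2 * (a + 2)) / (a + 1) ^+ 2); last first.
  by field; rewrite gt_eqF.
rewrite pmulr_lge0 ?invr_gt0 ?exprn_gt0// oppr_ge0 pmulr_lle0; last by lra.
by move=> h; apply/eqP; rewrite -sqrf_eq0 eq_le h sqr_ge0.
Qed.

End RealInnerProduct.

(** * Log-convex sequences *)

Section LogConvex.
Context {R : realType}.

(** Bounds on n-th roots are read off from infinitely many powers, without
    taking roots. *)
Lemma frequent_pow_ge1 (K q : R) : 0 < K -> 0 <= q ->
  (forall n, exists2 m, (n <= m)%N & K <= q ^+ m) -> 1 <= q.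
Proof.
move=> K0 q0 qK; rewrite leNgt; apply/negP => q1.
have h : q ^+ n @[n --> \oo] --> (0 : R) by apply: cvg_expr; rewrite ger0_norm.
have [N _ HN] := cvgr_lt _ h _ K0.
by have [m Nm] := qK N; have /= := HN m Nm; rewrite ltNge => /negP.
Qed.

Variable s : nat -> R.
Hypothesis s_convex : forall n, s n.+1 ^+ 2 <= s n * s n.+2.

Lemma log_convex_gt0 : (forall n, 0 <= s n) -> 0 < s 1%N -> forall n, 0 < s n.
Proof.
move=> s_ge0 s1; have sS n : 0 < s n.+1.
  elim: n => [//|n IH]; rewrite lt_def s_ge0 andbT; apply/eqP => sn.
  by have := s_convex n; rewrite sn mulr0 leNgt exprn_gt0.
case=> [|n]; last exact: sS.
rewrite lt_def s_ge0 andbT; apply/eqP => sn.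
by have := s_convex 0%N; rewrite sn mul0r leNgt exprn_gt0.
Qed.

Hypothesis s_gt0 : forall n, 0 < s n.
Let s_ge0 n : 0 <= s n. Proof. exact: ltW. Qed.

Lemma log_convex_ratio : {homo (fun n => s n.+1 / s n) : n m / (n <= m)%N >-> n <= m}.
Proof.
apply/nondecreasing_seqP => n.
by rewrite ler_pdivrMr// mulrAC ler_pdivlMr// -expr2 mulrC.
Qed.

Lemma log_convex_growth i m : s i * (s i.+1 / s i) ^+ m <= s (m + i)%N.
Proof.
elim: m => [|m IH]; first by rewrite mulr1.
rewrite exprSr mulrA addSn; apply: le_trans (ler_wpM2r _ IH) _; first exact: divr_ge0.
rewrite mulrC -ler_pdivlMr//.
exact/(log_convex_ratio (leq_addl m i)).
Qed.

(** A first ratio above 1 would persist and force geometric growth. *)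
Lemma log_convex_bounded M : (forall n, s n <= M) -> s 1%N <= s 0%N.
Proof.
move=> sM; have M0 : 0 < M by apply: lt_le_trans (sM 0%N).
suff : 1 <= s 0%N / s 1%N by rewrite ler_pdivlMr// mul1r.
apply: (@frequent_pow_ge1 (s 0%N / M)); rewrite ?divr_gt0 ?divr_ge0// => n.
exists n => //; have := log_convex_growth 0%N n; rewrite addn0 => h.
rewrite ler_pdivrMr// -invf_div exprVn mulrC ler_pdivlMr ?exprn_gt0 ?divr_gt0//.
exact: le_trans h (sM n).
Qed.

End LogConvex.

(** * Hyponormal operators *)

Section Hyponormal.
Context {R : realType} {V : lmodType R} (g : {dot V for @idfun R}).
Variables (T S : V -> V).
Hypothesis adjTS : forall x y, g (T x) y = g x (S y).
Hypothesis hypo : forall x, enorm g (S x) <= enorm g (T x).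

(** Operators with this property are called paranormal; it is all of
    hyponormality that the growth of single orbits depends on. *)
Lemma paranormal x : enorm g (T x) ^+ 2 <= enorm g x * enorm g (T (T x)).
Proof.
rewrite sqr_enorm adjTS; apply: le_trans (ip_le _ _ _) _.
by rewrite ler_wpM2l ?enorm_ge0.
Qed.

Lemma hyponormal_contraction M :
  (forall n x, enorm g (iter n T x) <= M * enorm g x) ->
  forall x, enorm g (T x) <= enorm g x.
Proof.
move=> TM x; have [Tx|Tx] := eqVneq (enorm g (T x)) 0; first by rewrite Tx enorm_ge0.
pose s n := enorm g (iter n T x).
have s_ge0 n : 0 <= s n by exact: enorm_ge0.
have s_convex n : s n.+1 ^+ 2 <= s n * s n.+2 by exact: paranormal.
apply: (log_convex_bounded s_convex _ (fun n => TM n x)).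
by apply: log_convex_gt0 => //; rewrite lt_def Tx enorm_ge0.
Qed.

(** Expanding the square, and using |S T u_j| <= |T T u_j| <= r^2 |u_j|,
    |S T u_j - r^2 u_j|^2 <= 2 r^2 (r^2 - c_j^2) |u_j|^2, which tends to 0.  As
    S T - r^2 is symmetric, it commutes with weak limits and kills [x]. *)
Lemma weak_limit_isometric (u : nat -> V) x (c : nat -> R) r B :
  (forall j, 0 <= c j <= r) -> (c j @[j --> \oo] --> r) ->
  (forall j, enorm g (T (u j)) = c j * enorm g (u j)) ->
  (forall j, enorm g (T (T (u j))) <= r ^+ 2 * enorm g (u j)) ->
  (forall j, enorm g (u j) <= B) ->
  wcvg g u x -> S (T x) = r ^+ 2 *: x.
Proof.
move=> c_le c_r Tu TTu uB ux.
have selfadj v w : g (S (T v)) w = g v (S (T w)).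
  by rewrite ipC -adjTS ipC adjTS.
have r0 : 0 <= r by have /andP[/le_trans] := c_le 0%N; apply.
have defect j : enorm g (S (T (u j)) - r ^+ 2 *: u j) ^+ 2
    <= 2 * r ^+ 2 * (r ^+ 2 - c j ^+ 2) * B ^+ 2.
  rewrite sqr_enorm !ipE (ipC g (S (T (u j))) (u j)).
  rewrite -(adjTS (u j) (T (u j))) -!sqr_enorm Tu.
  have h1 : enorm g (S (T (u j))) ^+ 2 <= (r ^+ 2 * enorm g (u j)) ^+ 2.
    rewrite ler_pXn2r ?nnegrE ?mulr_ge0 ?sqr_ge0 ?enorm_ge0//.
    exact: le_trans (hypo _) (TTu j).
  have h2 : 0 <= r ^+ 2 - c j ^+ 2.
    have /andP[c0 cr] := c_le j.
    by rewrite subr_ge0 ler_pXn2r// nnegrE (le_trans c0).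
  have h3 : 2 * r ^+ 2 * (r ^+ 2 - c j ^+ 2) * enorm g (u j) ^+ 2
    <= 2 * r ^+ 2 * (r ^+ 2 - c j ^+ 2) * B ^+ 2.
    rewrite ler_wpM2l ?mulr_ge0 ?sqr_ge0//.
    by rewrite ler_pXn2r ?nnegrE ?enorm_ge0// (le_trans (enorm_ge0 g (u j))).
  apply: le_trans h3; move: h1; lra.
apply: subr0_eq; apply: (@eq_ip _ _ g) => z; rewrite ip0l.
pose d v := S (T v) - r ^+ 2 *: v.
have dC v w : g (d v) w = g v (d w) by rewrite /d !ipE selfadj.
have dz : g (d (u j)) z @[j --> \oo] --> g (d x) z.
  by rewrite dC; under eq_fun do rewrite dC; exact: ux.
have d2 : g (d (u j)) z ^+ 2 @[j --> \oo] --> g (d x) z ^+ 2.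
  by rewrite expr2; under eq_fun do rewrite expr2; exact: cvgM.
have e0 : 2 * r ^+ 2 * (r ^+ 2 - c j ^+ 2) * B ^+ 2 * enorm g z ^+ 2 @[j --> \oo]
    --> 2 * r ^+ 2 * (r ^+ 2 - r ^+ 2) * B ^+ 2 * enorm g z ^+ 2.
  do 2!apply: cvgMr_tmp; apply: cvgMl_tmp; apply: cvgB; first exact: cvg_cst.
  by rewrite expr2; under eq_fun do rewrite expr2; exact: cvgM.
apply/eqP; rewrite -sqrf_eq0 eq_le sqr_ge0 andbT.
rewrite subrr mulr0 !mul0r in e0.
apply: (ler_cvg_to d2 e0); apply: nearW => j.
apply: le_trans (ler_wpM2r (sqr_ge0 _) (defect j)).
rewrite -exprMn -real_normK ?num_real//.
by rewrite ler_pXn2r ?nnegrE ?mulr_ge0 ?enorm_ge0// cauchy_schwarz.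
Qed.

End Hyponormal.

(** * Local spectral radius of a self-adjoint operator *)

Section StationaryVector.
Context {R : realType} {V : lmodType R} (g : {dot V for @idfun R}).
Variables (D : V -> V) (y : V) (d : R).
Hypothesis selfadj : forall v w, g (D v) w = g v (D w).
Hypothesis d_gt0 : 0 < d.
Hypothesis doubling : forall k, d * enorm g (iter (k + k) D y) <= enorm g (iter k D y) ^+ 2.

Lemma iter_selfadj k v w : g (iter k D v) w = g v (iter k D w).
Proof. by elim: k v w => [//|k IH] v w; rewrite iterSr IH selfadj. Qed.

Let s k := enorm g (iter k D y).
Let s_ge0 k : 0 <= s k. Proof. exact: enorm_ge0. Qed.

Let s_convex k : s k.+1 ^+ 2 <= s k * s k.+2.
Proof. by rewrite /s sqr_enorm /= selfadj ip_le. Qed.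

Let s_doubling n j : s (n * 2 ^ j)%N <= d * (s n / d) ^+ (2 ^ j).
Proof.
elim: j => [|j IH]; first by rewrite muln1 expr1 mulrC divfK ?gt_eqF.
rewrite expnS mul2n -addnn mulnDr -(ler_pM2l d_gt0).
apply: le_trans (doubling _) _; rewrite exprD.
rewrite [leRHS](_ : _ = (d * (s n / d) ^+ (2 ^ j)) ^+ 2); last first.
  by rewrite [RHS]expr2 mulrACA !mulrA.
by rewrite ler_pXn2r ?nnegrE ?mulr_ge0 ?exprn_ge0 ?divr_ge0 ?s_ge0 ?(ltW d_gt0).
Qed.

Hypothesis gcomp : ecomplete g.
Hypothesis Dy_neq0 : D y != 0.

Let s_gt0 k : 0 < s k.
Proof. by apply: log_convex_gt0 => //; exact: enorm_gt0. Qed.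

Let ratio i := s i.+1 / s i.

Let ratio_gt0 i : 0 < ratio i. Proof. exact: divr_gt0. Qed.

(** The heart of the matter: iterating [doubling] bounds s from above along the
    indices n 2^j by d (s_n / d)^(2^j), while log-convexity bounds it from below
    by a constant times (ratio i)^(n 2^j).  Letting j grow compares the bases. *)
Let ratio_pow i n : d * ratio i ^+ n <= s n.
Proof.
case: n => [|n].
  rewrite mulr1 -(ler_pM2r (s_gt0 0)) -expr2.
  exact: (doubling 0%N).
suff : 1 <= s n.+1 / (d * ratio i ^+ n.+1).
  by rewrite ler_pdivlMr ?mul1r// mulr_gt0// exprn_gt0.
apply: (@frequent_pow_ge1 _ (s i / (d * ratio i ^+ i))).
- by rewrite divr_gt0// mulr_gt0// exprn_gt0.
- by rewrite ltW// divr_gt0// mulr_gt0// exprn_gt0.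
move=> N; exists (2 ^ maxn N i)%N.
  by rewrite (leq_trans (leq_maxl N i))// ltnW// ltn_expl.
set m := (2 ^ _)%N.
have im : (i <= n.+1 * m)%N.
  rewrite (leq_trans (leq_maxr N i))// (leq_trans (ltnW (ltn_expl _ (isT : 1 < 2)%N)))//.
  by rewrite leq_pmull.
have : s i * ratio i ^+ (n.+1 * m - i) <= d * (s n.+1 / d) ^+ m.
  apply: le_trans (log_convex_growth s_convex s_gt0 _ _) _.
  by rewrite subnK//; exact: s_doubling.
move: (ratio i) (ratio_gt0 i) => q q_gt0 h.
have qX_gt0 k : 0 < q ^+ k by rewrite exprn_gt0.
rewrite expr_div_n exprMn -exprM ler_pdivlMr ?mulr_gt0 ?exprn_gt0//.
rewrite expr_div_n in h.
rewrite -(subnK im) exprD.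
have -> : s i / (d * q ^+ i) * (d ^+ m * (q ^+ (n.+1 * m - i) * q ^+ i))
    = s i * q ^+ (n.+1 * m - i) * (d ^+ m / d).
  by field; rewrite !gt_eqF.
apply: le_trans (ler_wpM2r _ h) _; first by rewrite ltW// divr_gt0// exprn_gt0.
rewrite le_eqVlt; apply/orP; left; apply/eqP; field.
by rewrite expf_neq0 gt_eqF.
Qed.

(** Let [r] be the limit of the ratios, the local spectral radius of [D] at [y].
    Then t_n = s_n / r^n decreases, and stays above [d] by [ratio_pow].  The
    vectors v_k = r^(-2k) D^(2k) y satisfy <v_i; v_j> = t_(i+j)^2, so they form
    a Cauchy sequence; its limit [w] is the orthogonal projection of [y] on the
    kernel of D^2 - r^2, which is why <y; w> = <w; w>. *)
Theorem stationary_vector : exists r w,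
  [/\ r != 0, D (D w) = r ^+ 2 *: w, g y w = g w w & d ^+ 2 <= g w w].
Proof.
have ratio_ub : has_ubound (range ratio).
  by exists (s 1%N / d) => _ [i _ <-]; rewrite ler_pdivlMr// mulrC; exact: (ratio_pow i 1).
have ratio_cvg := nondecreasing_cvgn (log_convex_ratio s_convex s_gt0) ratio_ub.
set r := sup _ in ratio_cvg.
have ratio_le i : ratio i <= r by apply: ub_le_sup => //; exists i.
have r_gt0 : 0 < r by apply: lt_le_trans (ratio_le 0%N).
have rX_gt0 n : 0 < r ^+ n by rewrite exprn_gt0.
have r_pow n : d * r ^+ n <= s n.
  have h : d * ratio i ^+ n @[i --> \oo] --> d * r ^+ n.
    apply: cvgMl_tmp; elim: n => [|n IH]; first exact: cvg_cst.
    by rewrite exprS; under eq_fun do rewrite exprS; exact: cvgM.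
  by apply: (cvgr_to_le h); apply: nearW => i.
pose t n := s n / r ^+ n.
have t_ge n : d <= t n by rewrite ler_pdivlMr.
have t_ge0 n : 0 <= t n by rewrite divr_ge0// ltW.
have t_dec : {homo t : m n / (m <= n)%N >-> n <= m}.
  apply/nonincreasing_seqP => n; rewrite /t exprS invfM mulrA ler_pM2r ?invr_gt0//.
  by rewrite ler_pdivrMr// mulrC -ler_pdivrMr//; exact: ratio_le.
have t_lb : has_lbound (range t) by exists d => _ [n _ <-].
have t_cvg := nonincreasing_cvgn t_dec t_lb.
set l := inf _ in t_cvg.
have l_le n : l <= t n by apply: ge_inf => //; exists n.
have l_ge : d <= l by apply: (cvgr_to_ge t_cvg); exact: nearW.
have l_ge0 : 0 <= l by rewrite (le_trans (ltW d_gt0)).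
have t2_cvg : t n ^+ 2 @[n --> \oo] --> l ^+ 2.
  by rewrite expr2; under eq_fun do rewrite expr2; exact: cvgM.
pose v k := (r ^+ (k + k))^-1 *: iter (k + k) D y.
have vE i j : g (v i) (v j) = t (i + j)%N ^+ 2.
  rewrite /v ipZl ipZr iter_selfadj -iterD.
  have -> : (i + i + (j + j) = (i + j) + (i + j))%N by rewrite addnACA.
  rewrite iterD -iter_selfadj -sqr_enorm -/(s _) /t expr_div_n mulrA -invfM -exprD.
  by rewrite -exprM muln2 -addnn addnACA mulrC.
have [w vw] : exists w, ecvg g v w.
  apply: gcomp => e e0.
  have e2 : l ^+ 2 < l ^+ 2 + e ^+ 2 / 2 by rewrite ltrDl divr_gt0// exprn_gt0.
  have [N _ HN] := cvgr_lt _ t2_cvg _ e2.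
  exists N => i j Ni Nj.
  rewrite -(@ltr_pXn2r _ 2)// ?nnegrE ?enorm_ge0 ?(ltW e0)// sqr_enorm.
  rewrite ipBl !ipBr (ipC g (v j) (v i)) !vE.
  have /= := HN (i + i)%N (leq_trans Ni (leq_addr _ _)).
  have /= := HN (j + j)%N (leq_trans Nj (leq_addr _ _)).
  have : l ^+ 2 <= t (i + j)%N ^+ 2 by rewrite ler_pXn2r ?nnegrE.
  move: (t _ ^+ 2) (t _ ^+ 2) (t _ ^+ 2) (l ^+ 2) (e ^+ 2) => *; lra.
have vw' := ecvg_wcvg vw.
have wv i : g w (v i) = l ^+ 2.
  apply: (cvg_unique _ (vw' (v i))) => //.
  rewrite (_ : (fun n => g (v n) (v i)) = fun n => t (n + i)%N ^+ 2).
    exact: cvg_comp (cvg_addnr i) t2_cvg.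
  by apply/funext => n; exact: vE.
have ww : g w w = l ^+ 2.
  apply: (cvg_unique _ (vw' w)) => //.
  rewrite (_ : (fun n => g (v n) w) = fun=> l ^+ 2); first exact: cvg_cst.
  by apply/funext => n; rewrite ipC wv.
exists r, w; split.
- by rewrite gt_eqF.
- apply: (@eq_ip _ _ g) => z; rewrite 2!selfadj ipZl.
  apply: (cvg_unique _ (vw' (D (D z)))) => //.
  have h : r ^+ 2 * g (v k.+1) z @[k --> \oo] --> r ^+ 2 * g w z.
    by apply: cvgMl_tmp; rewrite (cvg_shiftS (fun k => g (v k) z)); exact: vw'.
  apply: cvg_trans h; apply: near_eq_cvg; apply: nearW => k.
  rewrite /v !ipZl -2!selfadj mulrA addSn addnS /=; congr (_ * _).
  by rewrite !exprS; field; rewrite !gt_eqF.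
- rewrite ipC ww; have := wv 0%N.
  by rewrite /v addn0 invr1 scale1r.
- by rewrite ww ler_pXn2r ?nnegrE// ltW.
Qed.

End StationaryVector.

(** * Polynomials in a linear operator *)

Section OperatorPolynomial.
Context {R : comNzRingType} {V : lmodType R} (A : {linear V -> V}).

Implicit Types (p q : {poly R}) (x z : V).

Definition poly_op (p : {poly R}) x := \sum_(i < size p) p`_i *: iter i A x.

Lemma poly_op_widen n p x : (size p <= n)%N ->
  poly_op p x = \sum_(i < n) p`_i *: iter i A x.
Proof.
move=> pn; rewrite /poly_op (big_ord_widen _ (fun i => p`_i *: iter i A x) pn).
rewrite [RHS](bigID (fun i : 'I_n => (i < size p)%N))/= [X in _ + X]big1 ?addr0// => i.
by rewrite -leqNgt => pi; rewrite nth_default// scale0r.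
Qed.

Lemma poly_opDp p q x : poly_op (p + q) x = poly_op p x + poly_op q x.
Proof.
pose n := maxn (size p) (size q).
rewrite !(@poly_op_widen n) ?leq_maxl ?leq_maxr ?size_polyD//.
by rewrite -big_split; apply: eq_bigr => i _; rewrite coefD scalerDl.
Qed.

Lemma poly_opZp c p x : poly_op (c *: p) x = c *: poly_op p x.
Proof.
rewrite !(@poly_op_widen (size p)) ?size_scale_leq// scaler_sumr.
by apply: eq_bigr => i _; rewrite coefZ scalerA.
Qed.

Lemma poly_opC c x : poly_op c%:P x = c *: x.
Proof. by rewrite (@poly_op_widen 1) ?size_polyC_leq1// big_ord1 coefC. Qed.

Lemma poly_opMX p x : poly_op (p * 'X) x = poly_op p (A x).
Proof.
rewrite (@poly_op_widen (size p).+1); last first.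
  by rewrite (leq_trans (size_polyMleq _ _))// size_polyX addn2.
rewrite big_ord_recl coefMX scale0r add0r /poly_op.
by apply: eq_bigr => i _; rewrite coefMX /= -iterS iterSr.
Qed.

Lemma poly_op_comm (W : {linear V -> V}) p x :
  (forall z, W (A z) = A (W z)) -> W (poly_op p x) = poly_op p (W x).
Proof.
move=> WA; rewrite /poly_op linear_sum; apply: eq_bigr => i _; rewrite linearZ/=.
by congr (_ *: _); elim: (i : nat) => [//|j IH] /=; rewrite WA IH.
Qed.

Lemma poly_opM p q x : poly_op (p * q) x = poly_op p (poly_op q x).
Proof.
elim/poly_ind: p q => [|p c IH] q.
  by rewrite mul0r {1 2}/poly_op size_poly0 !big_ord0.
rewrite mulrDl poly_opDp -mulrA (mulrC 'X) IH poly_opMX -(poly_op_comm (W := A))//.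
by rewrite mul_polyC poly_opZp poly_opDp poly_opMX poly_opC.
Qed.

Lemma poly_opZ p c x : poly_op p (c *: x) = c *: poly_op p x.
Proof. by rewrite -[c *: x]poly_opC -poly_opM mulrC poly_opM poly_opC. Qed.

Lemma poly_op_exp p k x : poly_op (p ^+ k) x = iter k (poly_op p) x.
Proof.
elim: k => [|k IH]; first by rewrite expr0 poly_opC scale1r.
by rewrite exprS poly_opM IH.
Qed.

Lemma poly_op0 p : poly_op p 0 = 0.
Proof. by rewrite /poly_op big1// => i _; rewrite iter_fix ?linear0// scaler0. Qed.

Lemma poly_opD p x z : poly_op p (x + z) = poly_op p x + poly_op p z.
Proof.
rewrite /poly_op -big_split; apply: eq_bigr => i _ /=; rewrite -scalerDr.
by congr (_ *: _); elim: (i : nat) => [//|j IH] /=; rewrite IH linearD.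
Qed.

Lemma poly_opB p x z : poly_op p (x - z) = poly_op p x - poly_op p z.
Proof. by rewrite poly_opD -scaleN1r poly_opZ scaleN1r. Qed.

End OperatorPolynomial.

(** * Vectors with a purely atomic spectral measure *)

Section AlgebraicVector.
Context {R : realType} {V : lmodType R} (g : {dot V for @idfun R}).
Variables (A : {linear V -> V}) (y : V) (d : R).
Hypothesis gcomp : ecomplete g.
Hypothesis selfadj : forall v w, g (A v) w = g v (A w).

Lemma poly_op_selfadj p v w : g (poly_op A p v) w = g v (poly_op A p w).
Proof.
rewrite /poly_op (linear_sumlz g) linear_sumr.
by apply: eq_bigr => i _ /=; rewrite ipZl ipZr (iter_selfadj selfadj).
Qed.

Hypothesis d_gt0 : 0 < d.
Hypothesis squares : forall p,
  d * enorm g (poly_op A p (poly_op A p y)) <= enorm g (poly_op A p y) ^+ 2.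

(** In terms of the spectral measure of [A] at [y], [squares] bounds the mass of
    every non-null set from below by d^2, so there are finitely many atoms and
    nothing else.  If no nonzero
    p(A) killed [y], [stationary_vector] could be applied to p(A) again and again,
    multiplying p by p^2 - r^2 each time; the new vector is orthogonal to the
    earlier ones because p(A) kills those.  The invariant keeps only their sum
    [h], whose squared norm grows by d^2 at each step although
    |h|^2 = <y; h> forces |h| <= |y|. *)
Theorem algebraic_vector : exists2 p : {poly R}, p != 0 & poly_op A p y = 0.
Proof.
apply: contrapT => alg.
have py p : p != 0 -> poly_op A p y != 0.
  by move=> p0; apply/eqP => h; apply: alg; exists p.
have orth N : exists (p : {poly R}) h, [/\ (1 < size p)%N, poly_op A p h = 0,
    g y h = g h h & N%:R * d ^+ 2 <= g h h].
  elim: N => [|N [p [h [p1 ph yh hN]]]].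
    (* The constant 1 is no starting point: it has r = 1, and p^2 - r^2 = 0. *)
    by exists 'X, 0; rewrite size_polyX poly_op0 ip0r ip0l mul0r.
  have p0 : p != 0 by rewrite -size_poly_gt0 ltnW.
  have doubling k : d * enorm g (iter (k + k) (poly_op A p) y)
      <= enorm g (iter k (poly_op A p) y) ^+ 2.
    by rewrite iterD -!poly_op_exp; exact: squares.
  have [r [w [r0 DDw yw dw]]] :=
    stationary_vector (poly_op_selfadj p) d_gt0 doubling gcomp (py _ p0).
  pose q := p ^+ 2 - (r ^+ 2)%:P.
  have qE x : poly_op A q x = poly_op A p (poly_op A p x) - r ^+ 2 *: x.
    by rewrite poly_opDp -polyCN poly_opC scaleNr expr2 poly_opM.
  have q1 : (1 < size q)%N.
    have p2 : (1 < size (p ^+ 2))%N.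
      by rewrite expr2 size_mul//; move: (size p) p1 => n; lia.
    by rewrite /q size_polyDl// size_polyN (leq_ltn_trans (size_polyC_leq1 _)).
  have q0 : q != 0 by rewrite -size_poly_gt0 ltnW.
  have wh : g w h = 0.
    have : r ^+ 2 * g w h = 0.
      by rewrite -ipZl -DDw !poly_op_selfadj ph poly_op0 ip0r.
    by move/eqP; rewrite mulf_eq0 expf_eq0/= (negPf r0) => /eqP.
  exists (q * p), (h + w); split.
  - by rewrite size_mul//; move: (size p) (size q) p1 q1 => m n; lia.
  - by rewrite poly_opD poly_opM ph poly_op0 add0r mulrC poly_opM qE DDw subrr poly_op0.
  - by rewrite !ipE (ipC g h w) wh yh yw; lra.
  - by rewrite !ipE (ipC g h w) wh -natr1 mulrDl mul1r; lra.
have bound N : N%:R * d ^+ 2 <= enorm g y ^+ 2.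
  have [p [h [_ _ yh hN]]] := orth N.
  apply: le_trans hN _; have := ip_le g y h; rewrite yh -sqr_enorm.
  have := enorm_ge0 g h; have := enorm_ge0 g y.
  move: (enorm g y) (enorm g h) => a b a0 b0 ab.
  rewrite ler_pXn2r ?nnegrE//.
  have [b_gt0|] := ltP 0 b; last by move=> /le_trans; apply.
  by rewrite -(ler_pM2r b_gt0) -expr2.
have d2 : 0 < d ^+ 2 by rewrite exprn_gt0.
have := archi_boundP (divr_ge0 (sqr_ge0 (enorm g y)) (ltW d2)).
by rewrite ltr_pdivrMr// ltNge bound.
Qed.

End AlgebraicVector.

(** * Vectors whose isometric images exhaust the space *)

Section IsometricOrbit.
Context {R : realType} {V : lmodType R} (g : {dot V for @idfun R}).
Hypothesis gcomp : ecomplete g.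

Lemma wcvg_bounded u x : wcvg g u x -> exists B, forall j, enorm g (u j) <= B.
Proof.
move=> ux; have [z|B uB] := @uniform_boundedness _ _ g (range u) gcomp.
  have /cvg_seq_bounded[M [_ HM]] : cvgn (fun j => g (u j) z).
    by apply/cvg_ex; exists (g x z).
  exists (M + 1) => _ [j _ <-]; apply: HM => //; by rewrite ltrDl.
by exists B => j; apply: uB; exists j.
Qed.

(** [W] stands for the operators c U^n with U unitary and |c| = 1: the unimodular
    scalar c absorbs the argument of the coefficients, so that real multiples
    suffice in [W_limits] even over the complex numbers. *)
Variables (A : {linear V -> V}) (W : set {linear V -> V}) (y : V).
Hypothesis selfadj : forall v w, g (A v) w = g v (A w).
Hypothesis W_isometry : forall w, W w -> forall x, enorm g (w x) = enorm g x.
Hypothesis W_comm : forall w, W w -> forall x, w (A x) = A (w x).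
Hypothesis W_limits : forall x, exists (b : nat -> R) (w : nat -> {linear V -> V}),
  (forall j, W (w j)) /\ wcvg g (fun j => b j *: w j y) x.

(** In a weakly convergent sequence b_j w_j y the b_j are bounded, since the w_j
    are isometric.  Hence the set of all z with |<w y; z>| <= 1 for all w is weakly
    bounded, and uniform boundedness applies to it. *)
Lemma norming_orbit : y != 0 -> exists2 d, 0 < d & forall z c, 0 < c ->
  (forall w, W w -> `|g (w y) z| <= c) -> d * enorm g z <= c.
Proof.
move=> y0; have ny := enorm_gt0 g y0.
pose Z := [set z | forall w, W w -> `|g (w y) z| <= 1].
have [x|M ZM] := @uniform_boundedness _ _ g Z gcomp.
  have [b [w [Ww bw]]] := W_limits x.
  have [B bwB] := wcvg_bounded bw.
  exists (B / enorm g y) => z Zz; rewrite ipC.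
  apply: (cvgr_to_le (cvg_norm (bw z))); apply: nearW => j.
  rewrite ipZl normrM -[leRHS]mulr1 ler_pM//; last exact: Zz.
  by rewrite ler_pdivlMr// -(W_isometry (Ww j)) -enormZ.
have M0 : 0 <= M by rewrite -(enorm0 g) ZM// => w _; rewrite ip0r normr0.
exists (M + 1)^-1; first by rewrite invr_gt0; lra.
move=> z c c0 zc; rewrite mulrC ler_pdivrMr; last by lra.
have : enorm g (c^-1 *: z) <= M.
  apply: ZM => w Ww; rewrite ipZr normrM gtr0_norm ?invr_gt0// mulrC.
  by rewrite ler_pdivrMr// mul1r zc.
rewrite enormZ gtr0_norm ?invr_gt0// mulrC ler_pdivrMr// => /le_trans; apply.
by rewrite mulrC ler_pM2l//; lra.
Qed.

(** With B = p(A), <w y; B B y> = <w B y; B y> is at most |By|^2, so the norming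
    inequality at z = B B y is the hypothesis [squares] of [algebraic_vector]. *)
Theorem isometric_orbit_algebraic : exists2 p : {poly R}, p != 0 & poly_op A p y = 0.
Proof.
have [->|y0] := eqVneq y 0; first by exists 1; rewrite ?oner_neq0 ?poly_op0.
have [d d0 dP] := norming_orbit y0.
apply: (algebraic_vector gcomp selfadj d0) => p.
have [->|py0] := eqVneq (poly_op A p y) 0; first by rewrite poly_op0 enorm0 mulr0 expr0n.
apply: dP; first by rewrite exprn_gt0// enorm_gt0.
move=> w Ww; rewrite -(poly_op_selfadj selfadj) -(poly_op_comm (W := w)); last first.
  exact: W_comm.
by rewrite expr2 -[X in X * _](W_isometry Ww) cauchy_schwarz.
Qed.

End IsometricOrbit.

(** * Scalars and restriction of scalars to the reals *)

Section Scalars.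
Context {R : realType} {k : scalar_kind}.
Local Notation F := (scalar_field R k).
Implicit Types (r s : R) (a b : F).

Definition of_real : R -> F :=
  match k with RealScalars => idfun | ComplexScalars => real_complex R end.

Definition re_part : F -> R :=
  match k with RealScalars => idfun | ComplexScalars => @complex.Re R end.

Fact of_real_zmod_morphism : zmod_morphism of_real.
Proof. by rewrite /of_real; case: k => // r s; rewrite rmorphB. Qed.

Fact of_real_monoid_morphism : monoid_morphism of_real.
Proof.
by rewrite /of_real; case: k => //; split=> [|r s]; rewrite ?rmorph1 ?rmorphM.
Qed.

HB.instance Definition _ := GRing.isZmodMorphism.Build R F of_real of_real_zmod_morphism.
HB.instance Definition _ :=
  GRing.isMonoidMorphism.Build R F of_real of_real_monoid_morphism.

Fact re_part_zmod_morphism : zmod_morphism re_part.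
Proof. by rewrite /re_part; case: k => // -[? ?] [? ?]. Qed.

HB.instance Definition _ := GRing.isZmodMorphism.Build F R re_part re_part_zmod_morphism.

Lemma re_partZ r a : re_part (of_real r * a) = r * re_part a.
Proof.
move: a; rewrite /re_part /of_real; case: k => // -[a b] /=.
by rewrite mul0r subr0.
Qed.

Lemma re_part_of_real r : re_part (of_real r) = r.
Proof. by rewrite /re_part /of_real; case: k. Qed.

Lemma of_real_le r s : (of_real r <= of_real s) = (r <= s).
Proof. by rewrite /of_real; case: k => //=; rewrite lecR. Qed.

Lemma of_real_lt r s : (of_real r < of_real s) = (r < s).
Proof. by rewrite /of_real; case: k => //=; rewrite ltcR. Qed.

Lemma of_real_modulus a : of_real (modulus a) = `|a|.
Proof.
move: a; rewrite /of_real /modulus; case: k => a; first by [].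
exact/RRe_real/normr_real.
Qed.

Lemma of_real_inj : injective of_real.
Proof. by move=> r s /(congr1 re_part); rewrite !re_part_of_real. Qed.

Lemma modulus_of_real r : modulus (of_real r) = `|r|.
Proof.
apply: of_real_inj; rewrite of_real_modulus.
have [r0|r0] := leP 0 r.
  by rewrite !ger0_norm// -(rmorph0 of_real) of_real_le.
by rewrite !ltr0_norm ?rmorphN// -(rmorph0 of_real) of_real_lt.
Qed.

Lemma modulusM a b : modulus (a * b) = modulus a * modulus b.
Proof. by apply: of_real_inj; rewrite rmorphM /= !of_real_modulus normrM. Qed.

Lemma modulus_ge0 a : 0 <= modulus a.
Proof. by rewrite -of_real_le rmorph0 of_real_modulus. Qed.

Lemma modulus_eq0 a : (modulus a == 0) = (a == 0).
Proof. by rewrite -(inj_eq of_real_inj) rmorph0 of_real_modulus normr_eq0. Qed.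

Lemma re_part_le_modulus a : `|re_part a| <= modulus a.
Proof.
move: a; rewrite /re_part /modulus; case: k => //= a; rewrite -lecR.
by rewrite (RRe_real (normr_real a)) normc_ge_Re.
Qed.

Lemma sconjK a : sconj (sconj a) = a.
Proof. by move: a; rewrite /sconj; case: k => // a; rewrite conjcK. Qed.

Lemma sconj_of_real r : sconj (of_real r) = of_real r.
Proof. by rewrite /sconj /of_real; case: k => //; exact: conjc_real. Qed.

Lemma re_part_sconj a : re_part (sconj a) = re_part a.
Proof. by move: a; rewrite /sconj /re_part; case: k => // -[]. Qed.

Lemma mul_sconj a : a * sconj a = of_real (modulus a ^+ 2).
Proof.
rewrite rmorphXn /= of_real_modulus.
by move: a; rewrite /sconj; case: k => a; [rewrite real_normK ?num_real|rewrite sqr_normc].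
Qed.

Lemma re_part_mul_sconj a : re_part (a * sconj a) = modulus a ^+ 2.
Proof. by rewrite mul_sconj re_part_of_real. Qed.

Lemma sconj0 : sconj (0 : F) = 0.
Proof. by rewrite -(rmorph0 of_real) sconj_of_real. Qed.

Lemma modulusN a : modulus (- a) = modulus a.
Proof. by apply: of_real_inj; rewrite !of_real_modulus normrN. Qed.

Lemma modulus_sconj a : modulus (sconj a) = modulus a.
Proof.
apply/eqP; rewrite -(eqrXn2 (n := 2)) ?modulus_ge0//; apply/eqP/of_real_inj.
by rewrite -!mul_sconj sconjK mulrC.
Qed.

End Scalars.

(** An alias on which the R-module structure lives, so that it does not compete
    with the original module structure of [X]. *)
Definition realified (R : realType) (k : scalar_kind)
  (X : lmodType (scalar_field R k)) : Type := X.

Section Realified.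
Context {R : realType} {k : scalar_kind} {X : lmodType (scalar_field R k)}.
Local Notation V := (realified X).

HB.instance Definition _ := GRing.Zmodule.on V.

Definition real_scale (r : R) (x : V) : V := (of_real r : scalar_field R k) *: (x : X).

Fact real_scaleA r s x : real_scale r (real_scale s x) = real_scale (r * s) x.
Proof. by rewrite /real_scale scalerA rmorphM. Qed.
Fact real_scale1 : left_id 1 real_scale.
Proof. by move=> x; rewrite /real_scale rmorph1 scale1r. Qed.
Fact real_scaleDr : right_distributive real_scale +%R.
Proof. by move=> r x y; rewrite /real_scale scalerDr. Qed.
Fact real_scaleDl x : {morph real_scale^~ x : r s / r + s}.
Proof. by move=> r s; rewrite /real_scale rmorphD scalerDl. Qed.

HB.instance Definition _ := GRing.Zmodule_isLmodule.Build R V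
  real_scaleA real_scale1 real_scaleDr real_scaleDl.

Lemma realifiedZ r (x : V) : r *: x = of_real r *: (x : X).
Proof. by []. Qed.

Variable dot : {dot X for @sconj R k}.

Lemma dotC (x y : X) : dot x y = sconj (dot y x).
Proof. by rewrite (@hermitian_subproof _ _ false _ dot) expr0 mul1r. Qed.
Lemma dotDl (x y z : X) : dot (x + y) z = dot x z + dot y z.
Proof. exact: linearDl. Qed.
Lemma dotBl (x y z : X) : dot (x - y) z = dot x z - dot y z.
Proof. exact: linearBl. Qed.
Lemma dotZl a (x z : X) : dot (a *: x) z = a * dot x z.
Proof. exact: linearZl_LR. Qed.
Lemma dotBr (x y z : X) : dot z (x - y) = dot z x - dot z y.
Proof. exact: linearBr. Qed.
Lemma dotDr (x y z : X) : dot z (x + y) = dot z x + dot z y.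
Proof. exact: linearDr. Qed.
Lemma dotZr a (x z : X) : dot z (a *: x) = sconj a * dot z x.
Proof. exact: linearZr_LR. Qed.
Lemma dot_suml m (e : nat -> X) (c : nat -> scalar_field R k) z :
  dot (\sum_(i < m) c i *: e i) z = \sum_(i < m) c i * dot (e i) z.
Proof. by rewrite linear_sumlz; apply: eq_bigr => i _ /=; rewrite dotZl. Qed.

Definition re_dot (x y : V) : R := re_part (dot x y).

Fact re_dot_zmodl y : zmod_morphism (re_dot ^~ y).
Proof. by move=> u v; rewrite /re_dot dotBl raddfB. Qed.
Fact re_dot_zmodr x : zmod_morphism (re_dot x).
Proof. by move=> u v; rewrite /re_dot dotBr raddfB. Qed.
Fact re_dot_scalel y : scalable_for *%R (re_dot ^~ y).
Proof. by move=> r x; rewrite /re_dot dotZl re_partZ. Qed.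
Fact re_dot_scaler x : scalable_for (@idfun R \; *%R) (re_dot x).
Proof. by move=> r y; rewrite /re_dot dotZr sconj_of_real re_partZ. Qed.

HB.instance Definition _ := isBilinear.Build R V V R *%R (@idfun R \; *%R) re_dot
  re_dot_zmodl re_dot_zmodr re_dot_scalel re_dot_scaler.

Fact re_dot_hermitian x y : re_dot x y = (-1) ^+ false * idfun (re_dot y x).
Proof. by rewrite expr0 mul1r /re_dot /= dotC re_part_sconj. Qed.

HB.instance Definition _ := isHermitianSesquilinear.Build R V false (@idfun R) re_dot
  re_dot_hermitian.

Fact re_dot_gt0 x : x != 0 -> 0 < re_dot x x.
Proof.
move=> /(@neq0_dnorm_gt0 _ _ _ dot) xx; rewrite /re_dot -(ger0_norm (ltW xx)).
by rewrite -of_real_modulus re_part_of_real lt_def modulus_ge0 modulus_eq0 gt_eqF.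
Qed.

HB.instance Definition _ := isDotProduct.Build R V re_dot re_dot_gt0.

End Realified.

Definition bundle_linear (R : nzRingType) (U V : lmodType R) (f : U -> V)
  (lf : linear f) : {linear U -> V} := HB.pack f (GRing.isLinear.Build _ _ _ _ _ lf).

Definition bundle_scalar (R : nzRingType) (V : lmodType R) (f : V -> R)
  (lf : scalar f) : {scalar V} := HB.pack f (GRing.isLinear.Build _ _ _ _ _ lf).

Section RealifiedLinear.
Context {R : realType} {k : scalar_kind} {X : lmodType (scalar_field R k)}.
Variable f : {linear X -> X}.

Fact realified_is_linear : linear (f : realified X -> realified X).
Proof. by move=> r v w; rewrite realifiedZ; exact: linearP. Qed.

Definition realified_linear : {linear realified X -> realified X} :=
  bundle_linear realified_is_linear.

End RealifiedLinear.

(** * The real Hilbert space underlying X *)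

Section HilbertSpace.
Context {R : realType} {k : scalar_kind} {X : completeNormedModType (scalar_field R k)}.
Variable dot : {dot X for @sconj R k}.
Hypothesis dot_norm : inner_product_norm dot.
Local Notation F := (scalar_field R k).
Local Notation g := (re_dot dot : {dot realified X for @idfun R}).

Lemma of_real_rnorm (x : X) : of_real (rnorm x) = `|x| :> F.
Proof. by rewrite of_real_modulus normr_id. Qed.

Lemma enorm_re_dot (x : X) : enorm g x = rnorm x.
Proof.
rewrite /enorm /= /re_dot -dot_norm -of_real_rnorm -rmorphXn /= re_part_of_real sqrtr_sqr.
by rewrite ger0_norm// modulus_ge0.
Qed.

Lemma enorm_scale (a : F) (x : X) : enorm g (a *: x) = modulus a * enorm g x.
Proof.
rewrite !enorm_re_dot; apply: (@of_real_inj _ k).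
by rewrite rmorphM /= !of_real_rnorm normrZ of_real_modulus.
Qed.

(** Cauchy-Schwarz for [dot] follows from its real part: multiplying [x] by the
    conjugate of <x; y> makes the inner product real without loss. *)
Lemma modulus_dot_le (x y : X) : modulus (dot x y) <= enorm g x * enorm g y.
Proof.
have [->|a0] := eqVneq (dot x y) 0.
  by rewrite -(rmorph0 of_real) modulus_of_real normr0 mulr_ge0 ?enorm_ge0.
set a := dot x y in a0 *.
have ma : 0 < modulus a by rewrite lt_def modulus_eq0 a0 modulus_ge0.
rewrite -(ler_pM2l ma) -expr2 -re_part_mul_sconj mulrC -dotZl.
apply: le_trans (ip_le g (sconj a *: x) y) _.
by rewrite enorm_scale modulus_sconj mulrA.
Qed.

Lemma dot_continuous (z : X) : continuous (dot ^~ z).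
Proof.
move=> x; apply/cvgrPdist_lt => e e0.
have me : 0 < modulus e by rewrite lt_def modulus_eq0 gt_eqF// modulus_ge0.
have z1 : 0 < enorm g z + 1 by rewrite ltr_wpDl ?enorm_ge0.
have d0 : 0 < of_real (modulus e / (enorm g z + 1)) :> F.
  by rewrite -(rmorph0 of_real) of_real_lt divr_gt0.
apply/nbhs_normP; exists (of_real (modulus e / (enorm g z + 1))) => //= y.
rewrite /ball_ /= -of_real_rnorm -enorm_re_dot of_real_lt => xy.
rewrite -dotBl -of_real_modulus -(ger0_norm (ltW e0)) -of_real_modulus of_real_lt.
apply: le_lt_trans (modulus_dot_le _ _) _.
rewrite ltr_pdivlMr// in xy; apply: le_lt_trans xy.
by rewrite ler_wpM2l ?enorm_ge0 ?lerDl.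
Qed.

Lemma weakly_cvg_dot (u : nat -> X) x z : weakly_cvg u x ->
  modulus (dot (u j) z - dot x z) @[j --> \oo] --> (0 : R).
Proof.
move=> ux; have lz : scalar (dot ^~ z) by move=> a v w; rewrite dotDl dotZl.
have /cvgrPdist_lt h := ux (bundle_scalar lz) (@dot_continuous z).
apply/cvgrPdist_lt => e e0.
have e1 : 0 < of_real e :> F by rewrite -(rmorph0 of_real) of_real_lt.
have [N _ HN] := h _ e1; exists N => // n /= Nn.
have /= := HN n Nn.
rewrite -of_real_modulus of_real_lt sub0r normrN ger0_norm ?modulus_ge0//.
by rewrite -modulusN opprB.
Qed.

Lemma weakly_cvg_re_dot (u : nat -> X) x : weakly_cvg u x -> wcvg g u x.
Proof.
move=> ux z; apply: cvg_dist_le (weakly_cvg_dot z ux) => n.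
by rewrite /= /re_dot -raddfB; exact: re_part_le_modulus.
Qed.

Lemma re_dot_complete : ecomplete g.
Proof.
move=> u uc; have cu : cauchy ((u : nat -> X) @ \oo).
  apply/cauchyP => e e0.
  have me : 0 < modulus e by rewrite lt_def modulus_eq0 gt_eqF// modulus_ge0.
  have [N HN] := uc _ me; exists (u N); exists N => // n /= Nn.
  rewrite -ball_normE /= -of_real_rnorm -enorm_re_dot.
  by rewrite -(ger0_norm (ltW e0)) -of_real_modulus of_real_lt HN.
have /cvg_ex[l ul] : cvg ((u : nat -> X) @ \oo) by exact: cauchy_cvg cu.
exists l; apply/cvgrPdist_lt => e e0.
have e1 : 0 < of_real e :> F by rewrite -(rmorph0 of_real) of_real_lt.
move/cvgrPdist_lt : ul => /(_ _ e1)[N _ HN]; exists N => // n /= Nn.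
have /= := HN n Nn.
rewrite -of_real_rnorm -enorm_re_dot of_real_lt sub0r normrN ger0_norm ?enorm_ge0//.
by rewrite enormBC.
Qed.

Lemma eq_dot (v w : X) : (forall z, dot z v = dot z w) -> v = w.
Proof.
by move=> vw; apply: (@eq_ip _ _ g) => z; rewrite !(ipC g _ z) /= /re_dot vw.
Qed.

Lemma eq_re_dot (a b : F) : (forall c, re_part (c * a) = re_part (c * b)) -> a = b.
Proof.
move=> ab; apply/eqP; rewrite -subr_eq0 -modulus_eq0 -sqrf_eq0.
rewrite -re_part_mul_sconj mulrC mulrBr raddfB /=.
by rewrite ab subrr.
Qed.

Variable T : {linear X -> X}.

(** The Riesz vector of x |-> Re <Tx; y> also represents <Tx; y>, because the
    identity may be tested on all scalar multiples of x. *)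
Lemma adjointP M : (forall x, enorm g (T x) <= M * enorm g x) ->
  forall x y, dot (T x) y = dot x (adjoint dot T y).
Proof.
move=> TM x y; rewrite /adjoint.
suff : exists w, forall x, dot (T x) y = dot x w by move=> /(xgetPex 0); apply.
have lf : scalar (fun x : realified X => g (T x) y).
  by move=> r v w; rewrite -ipZl -ipDl realifiedZ linearD linearZ.
have [v|w wP] :=
  @riesz_representation _ _ g (bundle_scalar lf) (M * enorm g y) re_dot_complete.
  apply: le_trans (cauchy_schwarz _ _ _) _.
  by rewrite mulrAC ler_wpM2r ?enorm_ge0.
exists w => v; apply: eq_re_dot => c.
rewrite -!dotZl -linearZ; exact: wP.
Qed.

End HilbertSpace.

(** * Finite-dimensional subspaces are weakly closed *)

Section FiniteSpan.
Context {R : realType} {k : scalar_kind} {X : completeNormedModType (scalar_field R k)}.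
Variable dot : {dot X for @sconj R k}.
Hypothesis dot_norm : inner_product_norm dot.
Local Notation F := (scalar_field R k).

Definition in_span m (e : nat -> X) x := exists c : nat -> F, x = \sum_(i < m) c i *: e i.

Lemma dot_eq0C (x y : X) : dot x y = 0 -> dot y x = 0.
Proof. by move=> xy; rewrite dotC xy sconj0. Qed.

Lemma in_span_scale m e a x : in_span m e x -> in_span m e (a *: x).
Proof.
move=> [c ->]; exists (fun i => a * c i); rewrite scaler_sumr.
by apply: eq_bigr => i _; rewrite scalerA.
Qed.

(** Gram-Schmidt by induction: [w] is the part of e_m orthogonal to the earlier
    vectors, and the component of [v] along [w] is removed. *)
Lemma span_projection m (e : nat -> X) x : exists2 v,
  in_span m e (x - v) & forall i, (i < m)%N -> dot v (e i) = 0.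
Proof.
elim: m x => [|m IH] x.
  by exists x => //; exists (fun=> 0); rewrite big_ord0 subrr.
have [v [c xv] ve] := IH x; have [w [d ew] we] := IH (e m).
have [w0|w0] := eqVneq w 0.
  exists v.
    exists (fun i => if (i < m)%N then c i else 0).
    rewrite big_ord_recr /= ltnn scale0r addr0 xv.
    by apply: eq_bigr => i _; rewrite ltn_ord.
  move=> i; rewrite ltnS leq_eqVlt => /orP[/eqP->|]; last exact: ve.
  apply: dot_eq0C; rewrite -[e m](subrK w) ew w0 addr0 dot_suml big1// => i' _.
  by rewrite (dot_eq0C (ve _ (ltn_ord i'))) mulr0.
pose t := dot v w / dot w w.
have ww : dot w w != 0 by rewrite gt_eqF// neq0_dnorm_gt0.
have vwe i : (i < m)%N -> dot (v - t *: w) (e i) = 0.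
  by move=> im; rewrite dotBl dotZl ve// we// mulr0 subrr.
exists (v - t *: w).
  exists (fun i => if (i < m)%N then c i - t * d i else t).
  rewrite big_ord_recr /= ltnn -[e m](subrK w) ew scalerDr addrA.
  rewrite opprB addrCA xv addrC; congr (_ + _).
  rewrite scaler_sumr -big_split; apply: eq_bigr => i _ /=.
  by rewrite ltn_ord scalerA -scalerDl subrK.
move=> i; rewrite ltnS leq_eqVlt => /orP[/eqP->|]; last exact: vwe.
apply: dot_eq0C; rewrite -[e m](subrK w) ew dotDl dot_suml big1 ?add0r.
  apply: dot_eq0C; rewrite dotBl dotZl /t divfK// subrr //.
by move=> i' _; rewrite (dot_eq0C (vwe _ (ltn_ord i'))) mulr0.
Qed.

(** A weak limit of vectors of the span is orthogonal to everything that the span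
    is orthogonal to, in particular to its own residue under projection. *)
Lemma in_span_weakly_closed m e (u : nat -> X) x :
  (forall j, in_span m e (u j)) -> weakly_cvg u x -> in_span m e x.
Proof.
move=> ue ux; have [v xv ve] := span_projection m e x.
have span_orth z : in_span m e z -> dot z v = 0.
  move=> [c ->]; rewrite dot_suml big1// => i _.
  by rewrite (dot_eq0C (ve _ (ltn_ord i))) mulr0.
have xv0 : dot x v = 0.
  apply/eqP; rewrite -modulus_eq0 -modulusN -sub0r; apply/eqP.
  have := weakly_cvg_dot dot_norm v ux.
  under eq_fun do rewrite (span_orth _ (ue _)).
  by move=> /(cvg_unique _ (cvg_cst _)) ->.
have v0 : v = 0.
  apply/eqP; apply: contraT => /(@neq0_dnorm_gt0 _ _ _ dot).
  have := span_orth _ xv; rewrite dotBl xv0 sub0r => /eqP; rewrite oppr_eq0 => /eqP ->.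
  by rewrite ltxx.
by move: xv; rewrite v0 subr0.
Qed.

End FiniteSpan.

(** * Operator norms *)

Section OperatorNorm.
Context {R : realType} {k : scalar_kind} {X : completeNormedModType (scalar_field R k)}.
Variable dot : {dot X for @sconj R k}.
Hypothesis dot_norm : inner_product_norm dot.
Local Notation g := (re_dot dot : {dot realified X for @idfun R}).
Variable T : {linear X -> X}.

Lemma iter_linearZ n a x : iter n T (a *: x) = a *: iter n T x.
Proof. by elim: n => [//|n IH] /=; rewrite IH linearZ. Qed.

Lemma power_bounded_enorm : power_bounded T ->
  exists M, forall n x, enorm g (iter n T x) <= M * enorm g x.
Proof.
rewrite /power_bounded; set s := ereal_sup _ => s_lty.
exists (fine s) => n x.
have [->|x0] := eqVneq x 0.
  by rewrite -(scale0r 0) iter_linearZ !scale0r enorm0 mulr0.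
have nx := enorm_gt0 g x0.
pose e := of_real (enorm g x)^-1 *: x.
have e1 : enorm g e = 1.
  by rewrite enorm_scale// modulus_of_real ger0_norm ?invr_ge0 ?enorm_ge0// mulVf ?gt_eqF.
have es : ((enorm g (iter n T e))%:E <= s)%E.
  apply: (@le_trans _ _ (opnorm (iter n T))); last by apply: ereal_sup_ubound; exists n.
  by apply: ereal_sup_ubound; exists e; rewrite /= -!(enorm_re_dot dot_norm) ?e1.
have s_fin : s \is a fin_num.
  rewrite fin_real// s_lty andbT; apply: lt_le_trans es; exact: ltNyr.
move: es; rewrite -(fineK s_fin) lee_fin iter_linearZ enorm_scale// modulus_of_real.
by rewrite ger0_norm ?invr_ge0 ?enorm_ge0// mulrC ler_pdivrMr.
Qed.

Lemma contraction_enorm : (forall x, enorm g (T x) <= enorm g x) -> contraction_operator T.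
Proof.
move=> Tc; apply: ge_ereal_sup => _ [x /= x1 <-].
by rewrite lee_fin -(enorm_re_dot dot_norm) (le_trans (Tc x))// (enorm_re_dot dot_norm).
Qed.

End OperatorNorm.

(** * Supercyclic vectors of hyponormal operators *)

Lemma increasing_seq_ge (n : nat -> nat) : increasing_seq n -> forall j, (j <= n j)%N.
Proof.
move=> n_inc; elim=> [//|j IH]; apply: leq_ltn_trans IH _.
by rewrite ltnNge (n_inc j.+1 j : (n j.+1 <= n j)%N = _) ltnn.
Qed.

Section SupercyclicHyponormal.
Context {R : realType} {k : scalar_kind} {X : completeNormedModType (scalar_field R k)}.
Variable dot : {dot X for @sconj R k}.
Hypothesis dot_norm : inner_product_norm dot.
Local Notation F := (scalar_field R k).
Local Notation V := (realified X).
Local Notation g := (re_dot dot : {dot realified X for @idfun R}).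
Variables (T : {linear X -> X}) (S : X -> X) (y : X).
Hypothesis adjTS : forall x z, dot (T x) z = dot x (S z).
Hypothesis hypo : forall x, enorm g (S x) <= enorm g (T x).
Hypothesis T_contraction : forall x, enorm g (T x) <= enorm g x.
Hypothesis y_cyclic : weakly_l_sequentially_supercyclic_vector T y.

Let adjR x z : g (T x) z = g x (S z). Proof. by rewrite /= /re_dot adjTS. Qed.

(** The tails of the orbit of [y] span a weakly dense subspace: [z] itself is a
    weak limit of multiples of T^(n_j) y with n_j >= j. *)
Lemma supercyclic_eq0 N z : (forall n, (N <= n)%N -> dot (iter n T y) z = 0) -> z = 0.
Proof.
move=> Nz; have [a [n [_ n_inc uz]]] := y_cyclic.2 z.
have u0 : g (a j *: iter (n j) T y) z @[j --> \oo] --> 0.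
  apply: cvg_near_cst; exists N => // j /= Nj.
  by rewrite /re_dot dotZl Nz ?mulr0 ?raddf0// (leq_trans Nj)// increasing_seq_ge.
have uzg := weakly_cvg_re_dot dot_norm uz.
have z0 : g z z = 0 by exact: (cvg_unique _ (uzg z) u0).
exact: ip_eq0 z0.
Qed.

Lemma supercyclic_orbit_neq0 n : iter n T y != 0.
Proof.
apply/eqP => Ty0; have /eqP := y_cyclic.1; apply.
apply: (@supercyclic_eq0 n) => m /subnK <-.
by rewrite iterD Ty0 iter_fix ?linear0// linear0l.
Qed.

Let s n := enorm g (iter n T y).
Let s_gt0 n : 0 < s n. Proof. exact/enorm_gt0/supercyclic_orbit_neq0. Qed.
Let s_convex n : s n.+1 ^+ 2 <= s n * s n.+2.
Proof. exact: (@paranormal R V g T S adjR hypo (iter n T y)). Qed.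

(** [r] is the limit of the increasing ratios |T^(n+1) y| / |T^n y|.  These
    ratios do not change when T^n y is multiplied by a scalar, so
    [weak_limit_isometric] applies to every sequence a_j T^(n_j) y. *)
Lemma supercyclic_hyponormal_isometry :
  exists2 r, 0 < r & forall x, S (T x) = r ^+ 2 *: (x : V).
Proof.
pose ratio n := s n.+1 / s n.
have ratio_inc := log_convex_ratio s_convex s_gt0.
have ratio_ub : has_ubound (range ratio).
  by exists 1 => _ [n _ <-]; rewrite ler_pdivrMr// mul1r; exact: T_contraction.
have ratio_cvg := nondecreasing_cvgn ratio_inc ratio_ub.
set r := sup _ in ratio_cvg.
have ratio_le n : ratio n <= r by apply: ub_le_sup => //; exists n.
have ratio_ge0 n : 0 <= ratio n by rewrite divr_ge0// ltW.
exists r; first by apply: lt_le_trans (ratio_le 0%N); rewrite divr_gt0.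
move=> x; have [a [n [_ n_inc ux]]] := y_cyclic.2 x.
have uxg := weakly_cvg_re_dot dot_norm ux.
have [B uB] := wcvg_bounded (re_dot_complete dot_norm) uxg.
have Tu m (b : F) : enorm g (T (b *: iter m T y)) = ratio m * enorm g (b *: iter m T y).
  by rewrite linearZ !enorm_scale// mulrCA divfK// gt_eqF.
apply: (@weak_limit_isometric R V g T S adjR hypo _ x (ratio \o n) r B _ _ _ _ uB uxg).
- by move=> j /=; rewrite ratio_ge0 ratio_le.
- apply: cvg_comp ratio_cvg => A [N _ NA]; exists N => // j /= Nj.
  by apply: NA; rewrite /= (leq_trans Nj)// increasing_seq_ge.
- by move=> j; exact: Tu.
- move=> j; rewrite linearZ -iterS Tu expr2 -mulrA ler_pM// ?enorm_ge0//.
  by rewrite iterS -linearZ Tu ler_wpM2r ?enorm_ge0.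
Qed.

(** T S x - r^2 x is orthogonal to the range of T, hence to T^n y for n >= 1. *)
Lemma supercyclic_hyponormal_coisometry r :
  (forall x, S (T x) = r ^+ 2 *: (x : V)) -> forall x, T (S x) = r ^+ 2 *: (x : V).
Proof.
move=> STr x; apply/eqP; rewrite -subr_eq0; apply/eqP.
apply: (@supercyclic_eq0 1) => -[//|n] _.
rewrite iterS; set w := iter n T y.
by rewrite dotBr adjTS STr !realifiedZ !dotZr -adjTS subrr.
Qed.

End SupercyclicHyponormal.

(** * Multiples of unitary operators are not supercyclic *)

Section NoSupercyclicUnitary.
Context {R : realType} {k : scalar_kind} {X : completeNormedModType (scalar_field R k)}.
Variable dot : {dot X for @sconj R k}.
Hypothesis dot_norm : inner_product_norm dot.
Local Notation F := (scalar_field R k).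
Local Notation V := (realified X).
Local Notation g := (re_dot dot : {dot realified X for @idfun R}).
Variables (T : {linear X -> X}) (S : X -> X) (y : X) (r : R).
Hypothesis adjTS : forall x z, dot (T x) z = dot x (S z).
Hypothesis y_cyclic : weakly_l_sequentially_supercyclic_vector T y.
Hypothesis r_gt0 : 0 < r.
Hypothesis ST : forall x, S (T x) = r ^+ 2 *: (x : V).
Hypothesis TS : forall x, T (S x) = r ^+ 2 *: (x : V).

Let adjR x z : g (T x) z = g x (S z). Proof. by rewrite /= /re_dot adjTS. Qed.

Let SD x z : S (x + z) = S x + S z.
Proof. by apply: (@eq_dot _ _ _ dot) => w; rewrite dotDr -!adjTS dotDr. Qed.

Let SZ (a : F) x : S (a *: x) = a *: S x.
Proof. by apply: (@eq_dot _ _ _ dot) => w; rewrite dotZr -!adjTS dotZr. Qed.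

(** With U = T / r, the operator [re_T] is U + U*, twice the real part of U. *)
Let re_T : {linear X -> X}.
Proof.
apply: (@bundle_linear _ X X (fun x => of_real r^-1 *: (T x + S x))) => a v w.
by rewrite SD SZ linearP addrACA -scalerDr [LHS]scalerDr !scalerA mulrC.
Defined.

Let A := realified_linear re_T.

Let AE x : A x = r^-1 *: ((T x : V) + (S x : V)). Proof. by []. Qed.

Let A_selfadj v w : g (A v) w = g v (A w).
Proof.
rewrite !AE ipZl ipZr ipDl ipDr (adjR v w) (ipC g (S v) w) -(adjR w v).
by rewrite (ipC g (T w) v) addrC.
Qed.

Let TA x : T (A x) = A (T x).
Proof. by rewrite !AE !realifiedZ linearZ linearD /= ST TS. Qed.

Let AZ (a : F) x : A (a *: x) = a *: (A x : X).
Proof. exact: (linearZ_LR re_T). Qed.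

Let iterTA m x : iter m T (A x) = A (iter m T x).
Proof. by elim: m => [//|m IH] /=; rewrite IH TA. Qed.

Let enorm_iterT m x : enorm g (iter m T x) = r ^+ m * enorm g x.
Proof.
elim: m => [|m IH]; first by rewrite mul1r.
rewrite exprS -mulrA -IH /=; move: (iter m T x) => z.
apply/eqP; rewrite -(eqrXn2 (n := 2)) ?mulr_ge0 ?enorm_ge0 ?(ltW r_gt0)//.
by rewrite exprMn !sqr_enorm adjR ST ipZr.
Qed.

Let W : set {linear V -> V} := [set w | exists c m, modulus (c : F) = 1 /\
  forall x, w x = (c * of_real (r ^- m)) *: (iter m T x : X)].

Let W_bundle c m : modulus (c : F) = 1 -> exists2 w, W w &
  forall x, w x = (c * of_real (r ^- m)) *: (iter m T x : X).
Proof.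
move=> c1; have lw : linear (fun x : X => (c * of_real (r ^- m)) *: iter m T x).
  move=> b v w; have -> : iter m T (b *: v + w) = b *: iter m T v + iter m T w.
    by elim: m => [//|m IH] /=; rewrite IH linearP.
  by rewrite scalerDr !scalerA mulrC.
by exists (realified_linear (bundle_linear lw)) => //; exists c, m.
Qed.

(** a_j T^(n_j) y is the real multiple |a_j| r^(n_j) of c U^(n_j) y, with
    c = a_j / |a_j|. *)
Lemma supercyclic_algebraic : exists2 p : {poly R}, p != 0 & poly_op A p y = 0.
Proof.
apply: (@isometric_orbit_algebraic R V g (re_dot_complete dot_norm) A W y A_selfadj).
- move=> w [c [m [c1 wE]]] x; rewrite wE enorm_scale// modulusM c1 mul1r.
  rewrite modulus_of_real enorm_iterT ger0_norm ?invr_ge0 ?exprn_ge0 ?(ltW r_gt0)//.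
  by rewrite mulKf// expf_neq0 ?gt_eqF.
- by move=> w [c [m [c1 wE]]] x; rewrite !wE iterTA AZ.
move=> x; have [a [n [a0 n_inc ux]]] := y_cyclic.2 x.
have ma j : modulus (a j) != 0 by rewrite modulus_eq0.
have /choice[w wP] j : exists w, W w /\ forall x,
    w x = (a j / of_real (modulus (a j)) * of_real (r ^- n j)) *: (iter (n j) T x : X).
  have [|w Ww wE] := @W_bundle (a j / of_real (modulus (a j))) (n j); last by exists w.
  rewrite modulusM -fmorphV modulus_of_real ger0_norm ?invr_ge0 ?modulus_ge0//.
  by rewrite divff.
exists (fun j => modulus (a j) * r ^+ n j), w; split; first by move=> j; exact: (wP j).1.
have := weakly_cvg_re_dot dot_norm ux; congr (wcvg g _ x); apply/funext => j.
have mF : of_real (modulus (a j)) != 0 :> F by rewrite fmorph_eq0.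
have rF : of_real (r ^+ n j) != 0 :> F by rewrite fmorph_eq0 expf_neq0 ?gt_eqF.
have aE : of_real (modulus (a j) * r ^+ n j) *
    (a j / of_real (modulus (a j)) * of_real (r ^- n j)) = a j.
  by rewrite rmorphM fmorphV /= mulrACA divff // mulr1 mulrCA divff // mulr1.
by rewrite (wP j).2 realifiedZ scalerA aE.
Qed.

(** From A = U + U* one gets U (U y) = A (U y) - y, so every T^n y has the form
    P(A) y + Q(A) U y with real polynomials P and Q.  These may be reduced modulo
    the polynomial that annihilates [y], and with it U y, at [A]. *)
Lemma supercyclic_finite_dimensional : ~ infinite_dimensional X.
Proof.
apply; have [p p0 py] := supercyclic_algebraic.
pose m := size p; pose Uy : V := r^-1 *: (T y : V).
pose e i : X := if (i < m)%N then iter i A y else iter (i - m) A Uy.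
have rV : r != 0 by rewrite gt_eqF.
have TUy : T Uy = r *: (A Uy : V) - r *: (y : V).
  have SUy : S Uy = r *: (y : V).
    by rewrite /Uy !realifiedZ SZ ST realifiedZ scalerA -rmorphM expr2 mulKf.
  by rewrite AE scalerA divff// scale1r SUy addrK.
have T_poly q x : T (poly_op A q x) = poly_op A q (T x).
  by rewrite -[RHS](poly_op_comm (W := realified_linear T)).
have pUy : poly_op A p Uy = 0 by rewrite /Uy poly_opZ -T_poly py linear0 scaler0.
have orbit n : exists P Q, iter n T y = poly_op A P y + poly_op A Q Uy.
  elim: n => [|n [P [Q IH]]].
    by exists 1, 0; rewrite !poly_opC scale1r scale0r addr0.
  exists (- r *: Q), (r *: P + r *: (Q * 'X)).
  have Ty : T y = r *: Uy by rewrite /Uy scalerA divff// scale1r.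
  rewrite iterS IH linearD !T_poly Ty TUy -scalerBr !(poly_opZ _ _ r).
  rewrite poly_opB poly_opDp !poly_opZp poly_opMX scalerBr scaleNr.
  by rewrite addrA addrC.
have orbit_span n : in_span (m + m) e (iter n T y).
  have [P [Q ->]] := orbit n.
  have red (P' : {poly R}) v : poly_op A p v = 0 ->
      poly_op A P' v = \sum_(i < m) (P' %% p)`_i *: iter i A v.
    move=> pv; rewrite [in LHS](divp_eq P' p) poly_opDp poly_opM pv poly_op0 add0r.
    by rewrite -poly_op_widen// ltnW// ltn_modp.
  rewrite (red P)// (red Q)//.
  exists (fun i => of_real (if (i < m)%N then (P %% p)`_i else (Q %% p)`_(i - m))).
  rewrite big_split_ord /=; congr (_ + _); apply: eq_bigr => i _.
    by rewrite /e /= ltn_ord.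
  by rewrite /e /= ltnNge leq_addr /= addKn.
exists (m + m)%N, (fun i => e i) => x.
have [a [n [_ _ ux]]] := y_cyclic.2 x.
have u_span j := in_span_scale (a j) (orbit_span (n j)).
have [c ->] := in_span_weakly_closed dot_norm u_span ux.
by exists (fun i => c i).
Qed.

End NoSupercyclicUnitary.

Theorem corollary5p2 (R : realType) (k : scalar_kind)
    (X : completeNormedModType (scalar_field R k)) (dot : {dot X for sconj})
    (T : {linear X -> X}) :
  inner_product_norm dot ->
  infinite_dimensional X ->
  bounded_operator T ->
  power_bounded T ->
  hyponormal dot T ->
  contraction_operator T /\
  (~ weakly_l_sequentially_supercyclic T
   \/
   forall y : X, weakly_l_sequentially_supercyclic_vector T y ->
     unitary_operator T /\
     forall z : X, z != 0 ->
       limn_einf (fun n => (modulus (dot (iter n T y) z))%:E) = 0%E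
       \/
       exists n : nat -> nat,
         increasing_seq n /\
         (limn_esup (fun j => (modulus (dot (iter (n j) T y) z))%:E)
            < (rnorm z * rnorm y)%:E)%E).
Proof.
move=> dot_norm X_infinite _ T_pb T_hyp.
have [M TM] := power_bounded_enorm dot_norm T_pb.
have adjTS := adjointP dot_norm (TM 1%N).
have hypo x : enorm (re_dot dot) (adjoint dot T x) <= enorm (re_dot dot) (T x).
  by rewrite !(enorm_re_dot dot_norm) -(of_real_le (k := k)) !of_real_rnorm.
have T_contraction x : enorm (re_dot dot) (T x) <= enorm (re_dot dot) x.
  apply: (@hyponormal_contraction _ _ (re_dot dot) T (adjoint dot T) _ hypo M TM).
  by move=> v w; rewrite /= /re_dot adjTS.
split; first by apply: (contraction_enorm dot_norm) => x; exact: T_contraction.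
left=> -[y y_cyclic].
have [r r_gt0 ST] :=
  supercyclic_hyponormal_isometry dot_norm adjTS hypo T_contraction y_cyclic.
have TS := supercyclic_hyponormal_coisometry dot_norm adjTS y_cyclic ST.
exact: (supercyclic_finite_dimensional dot_norm adjTS y_cyclic r_gt0 ST TS X_infinite).
Qed.
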